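(* Let $(R,\theta,v)$ be GWA data. Suppose that there is a factorization $v=uw$ in $R$ such that the pairs $u,w$ and $u,\theta(w)$ are each relatively prime (i.e. each pair generates the unit ideal of $R$). Then $T(R,\theta,v)$ and $T(R,\theta,\theta(w)u)$ are strongly graded Morita equivalent.
   Context: **GWA.** GWA data $(R,\theta,v)$ consist of a finitely generated commutative $\mathbf{C}$-algebra $R$, a $\mathbf{C}$-algebra automorphism $\theta$ of $R$, and $v\in R$. $T(R,\theta,v)$ is the $\mathbf{C}$-algebra generated by $R$, $t_+$, $t_-$ subject to $$r t_+=t_+\theta(r),\quad \theta(r)t_-=t_-r,\quad t_-t_+=\theta(v),\quad t_+t_-=v\qquad(r\in R).$$ It is $\mathbf{Z}$-graded with $\deg t_+=1$, $\deg t_-=-1$, $\deg r=0$ for $r\in R$. **Strongly graded Morita equivalence.** For a graded ring $A$, $A\text{-}\mathrm{grMod}$ is the category of $\mathbf{Z}$-graded left $A$-modules with degree-preserving homomorphisms; the shift is $M[n]_i=M_{i+n}$. Graded algebras $A,B$ are strongly graded Morita equivalent if there is a $\mathbf{C}$-linear equivalence of categories $F:B\text{-}\mathrm{grMod}\to A\text{-}\mathrm{grMod}$ with $F(M[1])\cong F(M)[1]$ for every graded $B$-module $M$. *)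

(* Defs.v *)
From HB Require Import structures.
From mathcomp Require Import all_boot all_order all_algebra.
From mathcomp Require Import boolp classical_sets reals complex.
Import GRing.Theory.

Set Implicit Arguments.
Unset Strict Implicit.
Unset Printing Implicit Defensive.

Local Open Scope ring_scope.

Record is_grading (M : zmodType) (P : int -> set M) : Prop := IsGrading {
  grading0 : forall i, P i 0;
  gradingB : forall i x y, P i x -> P i y -> P i (x - y);
  grading_span : forall x, exists2 s : seq M,
    (forall y, y \in s -> exists i, P i y) & x = \sum_(y <- s) y;
  grading_free : forall (s : seq int) (f : int -> M),
    uniq s -> (forall i, P i (f i)) -> \sum_(i <- s) f i = 0 ->
    forall i, i \in s -> f i = 0
}.

Lemma gradingN (M : zmodType) (P : int -> set M) (gP : is_grading P) i x :
  P i x -> P i (- x).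
Proof. by move=> Px; rewrite -sub0r; apply: gradingB => //; apply: grading0. Qed.

Lemma gradingD (M : zmodType) (P : int -> set M) (gP : is_grading P) i x y :
  P i x -> P i y -> P i (x + y).
Proof.
by move=> Px Py; rewrite -[y]opprK; apply: gradingB => //; apply: gradingN.
Qed.

Lemma is_grading_shift (M : zmodType) (P : int -> set M) (n : int) :
  is_grading P -> is_grading (fun i => P (i + n)).
Proof.
move=> gP; split.
- by move=> i; apply: grading0.
- by move=> i x y; apply: gradingB.
- move=> x; have [s sP ->] := grading_span gP x.
  exists s => // y /sP[i Piy]; exists (i - n); by rewrite subrK.
- move=> s f us fP sum0 i is_.
  have := @grading_free _ _ gP [seq j + n | j <- s] (fun j => f (j - n)).
  rewrite map_inj_uniq; last exact: addIr.
  rewrite big_map; under eq_bigr do rewrite addrK.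
  have fP' j : P j (f (j - n)) by have := fP (j - n); rewrite subrK.
  move=> /(_ us fP' sum0 (i + n)); rewrite addrK; apply.
  exact: map_f.
Qed.

(* An algebra over K is a ring with a (central) structure map from K; the     *)
(* library's algType is not used because it excludes the zero ring.           *)
Record grAlg (K : fieldType) := GrAlg {
  gr_ring :> pzRingType;
  gr_in : {rmorphism K -> gr_ring};
  gr_in_central : forall k a, gr_in k * a = a * gr_in k;
  gr_piece : int -> set gr_ring;
  gr_grading : is_grading gr_piece;
  gr_in0 : forall k, gr_piece 0 (gr_in k);
  gr_pieceM : forall i j a b,
    gr_piece i a -> gr_piece j b -> gr_piece (i + j) (a * b)
}.

Record grMod (K : fieldType) (A : grAlg K) := GrMod {
  gm_mod :> lmodType A;
  gm_piece : int -> set gm_mod;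
  gm_grading : is_grading gm_piece;
  gm_pieceZ : forall i j (a : A) x,
    gr_piece i a -> gm_piece j x -> gm_piece (i + j) (a *: x)
}.

Definition grShift (K : fieldType) (A : grAlg K) (M : grMod A) (n : int) :
  grMod A.
Proof.
apply: (@GrMod K A M (fun i => gm_piece (i + n))).
- exact/is_grading_shift/gm_grading.
- by move=> i j a x ai xj; rewrite -addrA; apply: gm_pieceZ.
Defined.

Record grHom (K : fieldType) (A : grAlg K) (M N : grMod A) := GrHom {
  gh_fun :> M -> N;
  gh_linear : linear gh_fun;
  gh_deg : forall i x, gm_piece i x -> gm_piece i (gh_fun x)
}.

Section GrHom.
Context (K : fieldType) (A : grAlg K).

Lemma grHom_ext (M N : grMod A) (f g : grHom M N) : f =1 g -> f = g.
Proof.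
case: f g => [f fl fd] [g gl gd] /= /funext fg; subst g.
by congr GrHom; apply: Prop_irrelevance.
Qed.

Definition gh_id (M : grMod A) : grHom M M :=
  @GrHom K A M M id (fun _ _ _ => erefl) (fun _ _ => id).

Definition gh_comp (M N P : grMod A) (g : grHom N P) (f : grHom M N) :
  grHom M P.
Proof.
exists (g \o f).
- by move=> a x y /=; rewrite (gh_linear f) (gh_linear g).
- by move=> i x /(gh_deg f)/(gh_deg g).
Defined.

Definition gh_add (M N : grMod A) (f g : grHom M N) : grHom M N.
Proof.
exists (fun x => f x + g x).
- move=> a x y /=; rewrite (gh_linear f) (gh_linear g) scalerDr.
  by rewrite addrACA.
- move=> i x xi; apply: gradingD; first exact: gm_grading.
    exact: gh_deg.
  exact: gh_deg.
Defined.

Definition gh_scale (M N : grMod A) (k : K) (f : grHom M N) : grHom M N.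
Proof.
exists (fun x => gr_in A k *: f x).
- move=> a x y /=; rewrite (gh_linear f) scalerDr !scalerA.
  by rewrite gr_in_central.
- move=> i x xi; rewrite -(add0r i); apply: gm_pieceZ; first exact: gr_in0.
  exact: gh_deg.
Defined.

Definition gr_iso (M N : grMod A) : Prop :=
  exists (f : grHom M N) (g : grHom N M),
    gh_comp g f = gh_id M /\ gh_comp f g = gh_id N.

End GrHom.

Record grFunctor (K : fieldType) (A B : grAlg K) := GrFunctor {
  gf_ob :> grMod A -> grMod B;
  gf_map : forall M N : grMod A, grHom M N -> grHom (gf_ob M) (gf_ob N);
  gf_map_id : forall M, gf_map (gh_id M) = gh_id (gf_ob M);
  gf_map_comp : forall M N P (g : grHom N P) (f : grHom M N),
    gf_map (gh_comp g f) = gh_comp (gf_map g) (gf_map f)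
}.

Definition gf_id (K : fieldType) (A : grAlg K) : grFunctor A A :=
  @GrFunctor K A A id (fun _ _ => id) (fun _ => erefl)
    (fun _ _ _ _ _ => erefl).

Definition gf_comp (K : fieldType) (A B C : grAlg K)
  (G : grFunctor B C) (F : grFunctor A B) : grFunctor A C.
Proof.
apply: (@GrFunctor K A C (fun M => G (F M))
  (fun M N f => gf_map G (gf_map F f))).
- by move=> M; rewrite !gf_map_id.
- by move=> M N P g f; rewrite !gf_map_comp.
Defined.

Definition nat_iso (K : fieldType) (A B : grAlg K) (F G : grFunctor A B) :
  Prop :=
  exists (eta : forall M, grHom (F M) (G M))
         (eps : forall M, grHom (G M) (F M)),
    [/\ forall M, gh_comp (eps M) (eta M) = gh_id (F M),
        forall M, gh_comp (eta M) (eps M) = gh_id (G M)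
      & forall M N (f : grHom M N),
          gh_comp (eta N) (gf_map F f) = gh_comp (gf_map G f) (eta M)].

Definition is_equivalence (K : fieldType) (A B : grAlg K)
  (F : grFunctor A B) : Prop :=
  exists G : grFunctor B A,
    nat_iso (gf_comp G F) (gf_id A) /\ nat_iso (gf_comp F G) (gf_id B).

Definition is_klinear (K : fieldType) (A B : grAlg K)
  (F : grFunctor A B) : Prop :=
  forall M N : grMod A,
    (forall f g : grHom M N,
       gf_map F (gh_add f g) = gh_add (gf_map F f) (gf_map F g)) /\
    (forall (k : K) (f : grHom M N),
       gf_map F (gh_scale k f) = gh_scale k (gf_map F f)).

Definition strongly_graded_Morita_equivalent (K : fieldType) (A B : grAlg K) :
  Prop :=
  exists F : grFunctor B A,
    [/\ is_klinear F, is_equivalence F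
      & forall M : grMod B, gr_iso (F (grShift M 1)) (grShift (F M) 1)].

Inductive subalg_gen (K : fieldType) (R : pzRingType)
    (iota : {rmorphism K -> R}) (s : seq R) : set R :=
  | Subalg_gen x : x \in s -> subalg_gen iota s x
  | Subalg_in k : subalg_gen iota s (iota k)
  | Subalg_add x y : subalg_gen iota s x -> subalg_gen iota s y ->
      subalg_gen iota s (x + y)
  | Subalg_mul x y : subalg_gen iota s x -> subalg_gen iota s y ->
      subalg_gen iota s (x * y).

Record fgComAlg (K : fieldType) := FgComAlg {
  fg_ring :> comPzRingType;
  fg_in : {rmorphism K -> fg_ring};
  fg_fg : exists s : seq fg_ring, forall x, subalg_gen fg_in s x
}.

Record algAut (K : fieldType) (R : fgComAlg K) := AlgAut {
  aut_fun :> {rmorphism R -> R};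
  aut_bij : bijective aut_fun;
  aut_in : forall k, aut_fun (fg_in R k) = fg_in R k
}.

Definition relatively_prime (R : comPzRingType) (x y : R) : Prop :=
  exists a b : R, a * x + b * y = 1.

Inductive gwa_term (R : Type) :=
  | GBase of R
  | GTp
  | GTm
  | GAdd of gwa_term R & gwa_term R
  | GOpp of gwa_term R
  | GMul of gwa_term R & gwa_term R.

Arguments GTp {R}.
Arguments GTm {R}.

HB.instance Definition _ (R : Type) := gen_eqMixin (gwa_term R).
HB.instance Definition _ (R : Type) := gen_choiceMixin (gwa_term R).

(* The least congruence for which the quotient is a ring, R maps to it by a   *)
(* ring morphism and the four defining relations hold.  Scalars are those of  *)
(* R, so that no separate generators or relations are needed for them.        *)
Inductive gwa_eq (K : fieldType) (R : fgComAlg K) (theta : algAut R) (v : R) :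
    gwa_term R -> gwa_term R -> Prop :=
  | GE_refl a : gwa_eq theta v a a
  | GE_sym a b : gwa_eq theta v a b -> gwa_eq theta v b a
  | GE_trans a b c :
      gwa_eq theta v a b -> gwa_eq theta v b c -> gwa_eq theta v a c
  | GE_addc a b c d : gwa_eq theta v a b -> gwa_eq theta v c d ->
      gwa_eq theta v (GAdd a c) (GAdd b d)
  | GE_oppc a b : gwa_eq theta v a b -> gwa_eq theta v (GOpp a) (GOpp b)
  | GE_mulc a b c d : gwa_eq theta v a b -> gwa_eq theta v c d ->
      gwa_eq theta v (GMul a c) (GMul b d)
  | GE_addA a b c :
      gwa_eq theta v (GAdd a (GAdd b c)) (GAdd (GAdd a b) c)
  | GE_addC a b : gwa_eq theta v (GAdd a b) (GAdd b a)
  | GE_add0 a : gwa_eq theta v (GAdd (GBase 0) a) a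
  | GE_addN a : gwa_eq theta v (GAdd (GOpp a) a) (GBase 0)
  | GE_mulA a b c :
      gwa_eq theta v (GMul a (GMul b c)) (GMul (GMul a b) c)
  | GE_mul1l a : gwa_eq theta v (GMul (GBase 1) a) a
  | GE_mul1r a : gwa_eq theta v (GMul a (GBase 1)) a
  | GE_mulDl a b c :
      gwa_eq theta v (GMul (GAdd a b) c) (GAdd (GMul a c) (GMul b c))
  | GE_mulDr a b c :
      gwa_eq theta v (GMul a (GAdd b c)) (GAdd (GMul a b) (GMul a c))
  | GE_baseD r s :
      gwa_eq theta v (GBase (r + s)) (GAdd (GBase r) (GBase s))
  | GE_baseM r s :
      gwa_eq theta v (GBase (r * s)) (GMul (GBase r) (GBase s))
  | GE_tp r :
      gwa_eq theta v (GMul (GBase r) GTp) (GMul GTp (GBase (theta r)))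
  | GE_tm r :
      gwa_eq theta v (GMul (GBase (theta r)) GTm) (GMul GTm (GBase r))
  | GE_tmp : gwa_eq theta v (GMul GTm GTp) (GBase (theta v))
  | GE_tpm : gwa_eq theta v (GMul GTp GTm) (GBase v).

Section GWA.
Context (K : fieldType) (R : fgComAlg K) (theta : algAut R) (v : R).
Local Open Scope quotient_scope.

Definition gwa_eqb : rel (gwa_term R) := fun a b => `[< gwa_eq theta v a b >].

Lemma gwa_eqb_equiv : equiv_class_of gwa_eqb.
Proof.
split.
- by move=> a; apply/asboolP; apply: GE_refl.
- by move=> a b; apply/asboolP/asboolP; apply: GE_sym.
- move=> b a c /asboolP ab /asboolP bc; apply/asboolP.
  exact: GE_trans ab bc.
Qed.

Canonical gwa_eqb_equiv_rel := EquivRelPack gwa_eqb_equiv.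

Definition gwa := {eq_quot gwa_eqb}.
HB.instance Definition _ := Choice.on gwa.
HB.instance Definition _ := EqQuotient.on gwa.

Lemma gwa_piP (a b : gwa_term R) :
  gwa_eq theta v a b <-> \pi_gwa a = \pi_gwa b.
Proof.
split=> [ab|]; first by apply/eqquotP/asboolP.
by move/eqquotP/asboolP.
Qed.

Lemma gwa_reprP (a : gwa_term R) : gwa_eq theta v (repr (\pi_gwa a)) a.
Proof. by apply/gwa_piP; rewrite reprK. Qed.

Definition gwa_add := lift_op2 gwa (@GAdd R).
Definition gwa_opp := lift_op1 gwa (@GOpp R).
Definition gwa_mul := lift_op2 gwa (@GMul R).

Lemma gwa_addE a b : gwa_add (\pi_gwa a) (\pi_gwa b) = \pi_gwa (GAdd a b).
Proof.
rewrite /gwa_add; unlock.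
by apply/gwa_piP; apply: GE_addc; apply: gwa_reprP.
Qed.

Lemma gwa_oppE a : gwa_opp (\pi_gwa a) = \pi_gwa (GOpp a).
Proof.
rewrite /gwa_opp; unlock.
by apply/gwa_piP; apply: GE_oppc; apply: gwa_reprP.
Qed.

Lemma gwa_mulE a b : gwa_mul (\pi_gwa a) (\pi_gwa b) = \pi_gwa (GMul a b).
Proof.
rewrite /gwa_mul; unlock.
by apply/gwa_piP; apply: GE_mulc; apply: gwa_reprP.
Qed.

Let piE := (gwa_addE, gwa_oppE, gwa_mulE).

Lemma gwa_addA : associative gwa_add.
Proof.
elim/quotW=> a; elim/quotW=> b; elim/quotW=> c.
by rewrite !piE; apply/gwa_piP; constructor.
Qed.

Lemma gwa_addC : commutative gwa_add.
Proof.
by elim/quotW=> a; elim/quotW=> b; rewrite !piE; apply/gwa_piP; constructor.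
Qed.

Lemma gwa_add0 : left_id (\pi_gwa (GBase 0)) gwa_add.
Proof. by elim/quotW=> a; rewrite !piE; apply/gwa_piP; constructor. Qed.

Lemma gwa_addN : left_inverse (\pi_gwa (GBase 0)) gwa_opp gwa_add.
Proof. by elim/quotW=> a; rewrite !piE; apply/gwa_piP; constructor. Qed.

HB.instance Definition _ :=
  GRing.isZmodule.Build gwa gwa_addA gwa_addC gwa_add0 gwa_addN.

Lemma gwa_mulA : associative gwa_mul.
Proof.
elim/quotW=> a; elim/quotW=> b; elim/quotW=> c.
by rewrite !piE; apply/gwa_piP; constructor.
Qed.

Lemma gwa_mul1l : left_id (\pi_gwa (GBase 1)) gwa_mul.
Proof. by elim/quotW=> a; rewrite !piE; apply/gwa_piP; constructor. Qed.

Lemma gwa_mul1r : right_id (\pi_gwa (GBase 1)) gwa_mul.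
Proof. by elim/quotW=> a; rewrite !piE; apply/gwa_piP; constructor. Qed.

Lemma gwa_mulDl : left_distributive gwa_mul (@GRing.add gwa).
Proof.
elim/quotW=> a; elim/quotW=> b; elim/quotW=> c.
by rewrite /GRing.add /= !piE; apply/gwa_piP; constructor.
Qed.

Lemma gwa_mulDr : right_distributive gwa_mul (@GRing.add gwa).
Proof.
elim/quotW=> a; elim/quotW=> b; elim/quotW=> c.
by rewrite /GRing.add /= !piE; apply/gwa_piP; constructor.
Qed.

HB.instance Definition _ := GRing.Zmodule_isPzRing.Build gwa
  gwa_mulA gwa_mul1l gwa_mul1r gwa_mulDl gwa_mulDr.

Definition gwa_base (r : R) : gwa := \pi_gwa (GBase r).
Definition gwa_tp : gwa := \pi_gwa GTp.
Definition gwa_tm : gwa := \pi_gwa GTm.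

Lemma gwa_piD a b : \pi_gwa (GAdd a b) = \pi_gwa a + \pi_gwa b.
Proof. by rewrite -gwa_addE. Qed.

Lemma gwa_piN a : \pi_gwa (GOpp a) = - \pi_gwa a.
Proof. by rewrite -gwa_oppE. Qed.

Lemma gwa_piM a b : \pi_gwa (GMul a b) = \pi_gwa a * \pi_gwa b.
Proof. by rewrite -gwa_mulE. Qed.

Lemma gwa_baseD r s : gwa_base (r + s) = gwa_base r + gwa_base s.
Proof. by rewrite -gwa_piD; apply/gwa_piP; constructor. Qed.

Lemma gwa_baseM r s : gwa_base (r * s) = gwa_base r * gwa_base s.
Proof. by rewrite -gwa_piM; apply/gwa_piP; constructor. Qed.

Lemma gwa_base_nmod : nmod_morphism gwa_base.
Proof. by split=> // r s; apply: gwa_baseD. Qed.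

Lemma gwa_base_monoid : monoid_morphism gwa_base.
Proof. by split=> // r s; apply: gwa_baseM. Qed.

HB.instance Definition _ :=
  GRing.isNmodMorphism.Build R gwa gwa_base gwa_base_nmod.
HB.instance Definition _ :=
  GRing.isMonoidMorphism.Build R gwa gwa_base gwa_base_monoid.

Lemma gwa_tpE r : gwa_base r * gwa_tp = gwa_tp * gwa_base (theta r).
Proof. by rewrite -!gwa_piM; apply/gwa_piP; constructor. Qed.

Lemma gwa_tmE r : gwa_base (theta r) * gwa_tm = gwa_tm * gwa_base r.
Proof. by rewrite -!gwa_piM; apply/gwa_piP; constructor. Qed.

Lemma gwa_tmpE : gwa_tm * gwa_tp = gwa_base (theta v).
Proof. by rewrite -!gwa_piM; apply/gwa_piP; constructor. Qed.

Lemma gwa_tpmE : gwa_tp * gwa_tm = gwa_base v.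
Proof. by rewrite -!gwa_piM; apply/gwa_piP; constructor. Qed.

Lemma gwa_ind (P : gwa -> Prop) :
  (forall r, P (gwa_base r)) -> P gwa_tp -> P gwa_tm ->
  (forall x y, P x -> P y -> P (x + y)) -> (forall x, P x -> P (- x)) ->
  (forall x y, P x -> P y -> P (x * y)) -> forall x, P x.
Proof.
move=> Pb Pp Pm PD PN PM; elim/quotW; elim=> //.
- by move=> a Pa b Pb'; rewrite gwa_piD; apply: PD.
- by move=> a Pa; rewrite gwa_piN; apply: PN.
- by move=> a Pa b Pb'; rewrite gwa_piM; apply: PM.
Qed.

Definition gwa_in : K -> gwa := gwa_base \o fg_in R.
HB.instance Definition _ := GRing.RMorphism.on gwa_in.

Lemma gwa_in_central k (x : gwa) : gwa_in k * x = x * gwa_in k.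
Proof.
elim/gwa_ind: x => [r|||x y xE yE|x xE|x y xE yE] /=.
- by rewrite -!gwa_baseM mulrC.
- by rewrite gwa_tpE aut_in.
- by rewrite -gwa_tmE aut_in.
- by rewrite mulrDr mulrDl xE yE.
- by rewrite mulrN mulNr xE.
- by rewrite mulrA xE -mulrA yE mulrA.
Qed.

Inductive gwa_piece : int -> set gwa :=
  | GP_base r : gwa_piece 0 (gwa_base r)
  | GP_tp : gwa_piece 1 gwa_tp
  | GP_tm : gwa_piece (-1) gwa_tm
  | GP_zero i : gwa_piece i 0
  | GP_sub i x y : gwa_piece i x -> gwa_piece i y -> gwa_piece i (x - y)
  | GP_mul i j x y :
      gwa_piece i x -> gwa_piece j y -> gwa_piece (i + j) (x * y).

Lemma gwa_span x : exists2 s : seq gwa,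
  (forall y, y \in s -> exists i, gwa_piece i y) & x = \sum_(y <- s) y.
Proof.
have hom1 y i : gwa_piece i y -> exists2 s : seq gwa,
    (forall z, z \in s -> exists i, gwa_piece i z) & y = \sum_(z <- s) z.
  move=> yi; exists [:: y]; last by rewrite big_seq1.
  by move=> z; rewrite inE => /eqP->; exists i.
elim/gwa_ind: x => [r|||x y [s sP ->] [t tP ->]|x [s sP ->]
                   |x y [s sP ->] [t tP ->]].
- by apply: (hom1 _ 0); constructor.
- by apply: (hom1 _ 1); constructor.
- by apply: (hom1 _ (-1)); constructor.
- exists (s ++ t); last by rewrite big_cat.
  by move=> z; rewrite mem_cat => /orP[/sP|/tP].
- exists [seq - z | z <- s]; last by rewrite big_map sumrN.
  move=> _ /mapP[z /sP[i zi] ->]; exists i; rewrite -sub0r.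
  by apply: GP_sub => //; apply: GP_zero.
- exists [seq a * b | a <- s, b <- t].
    move=> _ /allpairsP[[a b] /= [/sP[i ai] /tP[j bj] ->]].
    by exists (i + j); apply: GP_mul.
  by rewrite big_allpairs_dep mulr_suml; apply: eq_bigr => a _; rewrite mulr_sumr.
Qed.

(* Freeness of the grading: a term acts on functions int -> gwa through its   *)
(* homogeneous components, and applying it to the delta function at 0         *)
(* recovers them.                                                             *)
Fixpoint gwa_act (a : gwa_term R) (phi : int -> gwa) : int -> gwa :=
  match a with
  | GBase r => fun n => gwa_base r * phi n
  | GTp => fun n => gwa_tp * phi (n - 1)
  | GTm => fun n => gwa_tm * phi (n + 1)
  | GAdd a b => fun n => gwa_act a phi n + gwa_act b phi n
  | GOpp a => fun n => - gwa_act a phi n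
  | GMul a b => gwa_act a (gwa_act b phi)
  end.

Lemma gwa_act_ext a phi psi : phi =1 psi -> gwa_act a phi =1 gwa_act a psi.
Proof. by move/funext->. Qed.

Lemma gwa_actD a phi psi n :
  gwa_act a (fun m => phi m + psi m) n = gwa_act a phi n + gwa_act a psi n.
Proof.
elim: a phi psi n => [r|||a IHa b IHb|a IHa|a IHa b IHb] phi psi n /=;
  rewrite ?mulrDr //.
- by rewrite IHa IHb addrACA.
- by rewrite IHa opprD.
- by rewrite (gwa_act_ext a (IHb phi psi)) IHa.
Qed.

Lemma gwa_act_eq a b : gwa_eq theta v a b -> gwa_act a = gwa_act b.
Proof.
move=> ab; apply/funext => phi; apply/funext => n.
elim: ab phi n => {a b} /=.
- by [].
- by move=> a b _ IH phi n; rewrite IH.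
- by move=> a b c _ IH1 _ IH2 phi n; rewrite IH1.
- by move=> a b c d _ IH1 _ IH2 phi n; rewrite IH1 IH2.
- by move=> a b _ IH phi n; rewrite IH.
- by move=> a b c d _ IH1 _ IH2 phi n; rewrite IH1 (gwa_act_ext b (IH2 phi)).
- by move=> a b c phi n; rewrite addrA.
- by move=> a b phi n; rewrite addrC.
- by move=> a phi n; rewrite [gwa_base 0]raddf0 mul0r add0r.
- by move=> a phi n; rewrite addNr [gwa_base 0]raddf0 mul0r.
- by [].
- move=> a phi n; rewrite (_ : gwa_base 1 = 1) // mul1r //.
- move=> a phi n; apply: gwa_act_ext => m.
  by rewrite (_ : gwa_base 1 = 1) // mul1r.
- by [].
- by move=> a b c phi n; rewrite gwa_actD.
- by move=> r s phi n; rewrite gwa_baseD mulrDl.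
- by move=> r s phi n; rewrite gwa_baseM mulrA.
- by move=> r phi n; rewrite !mulrA gwa_tpE.
- by move=> r phi n; rewrite !mulrA gwa_tmE.
- by move=> phi n; rewrite mulrA gwa_tmpE addrK.
- by move=> phi n; rewrite mulrA gwa_tpmE subrK.
Qed.

Lemma gwa_act_repr a : gwa_act (repr (\pi_gwa a)) = gwa_act a.
Proof. exact/gwa_act_eq/gwa_reprP. Qed.

Lemma gwa_act_piece i x phi n :
  gwa_piece i x -> gwa_act (repr x) phi n = x * phi (n - i).
Proof.
move=> xi; elim: xi phi n => {i x}.
- by move=> r phi n; rewrite gwa_act_repr subr0.
- by move=> phi n; rewrite gwa_act_repr.
- by move=> phi n; rewrite gwa_act_repr opprK.
- move=> i phi n; have E : gwa_base 0 = 0 by apply: raddf0.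
  have := gwa_act_repr (GBase 0); rewrite -/(gwa_base 0) E => -> /=.
  by rewrite E !mul0r.
- move=> i x y _ IHx _ IHy phi n.
  have -> : x - y = \pi_gwa (GAdd (repr x) (GOpp (repr y))).
    by rewrite gwa_piD gwa_piN !reprK.
  by rewrite gwa_act_repr /= IHx IHy gwa_piD gwa_piN !reprK mulrBl.
- move=> i j x y _ IHx _ IHy phi n.
  have -> : x * y = \pi_gwa (GMul (repr x) (repr y)).
    by rewrite gwa_piM !reprK.
  rewrite gwa_act_repr /= IHx IHy gwa_piM !reprK mulrA.
  by rewrite opprD addrA.
Qed.

Lemma gwa_free (s : seq int) (f : int -> gwa) :
  uniq s -> (forall i, gwa_piece i (f i)) -> \sum_(i <- s) f i = 0 ->
  forall i, i \in s -> f i = 0.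
Proof.
move=> us fP sum0 i i_s.
pose comp (x : gwa) := gwa_act (repr x) (fun n => (n == 0)%:R) i.
have compD x y : comp (x + y) = comp x + comp y.
  rewrite /comp; have -> : x + y = \pi_gwa (GAdd (repr x) (repr y)).
    by rewrite gwa_piD !reprK.
  by rewrite gwa_act_repr.
have comp0 : comp 0 = 0 by rewrite /comp (gwa_act_piece _ _ (GP_zero i)) mul0r.
have compf j : comp (f j) = if j == i then f i else 0.
  rewrite /comp (gwa_act_piece _ _ (fP j)) subr_eq0 [i == j]eq_sym.
  by case: eqP => [->|_]; rewrite ?mulr1 ?mulr0.
have := congr1 comp sum0; rewrite comp0 (big_morph comp compD comp0).
under eq_bigr do rewrite compf.
by rewrite -big_mkcond (big_rem i) //= eqxx big1_seq ?addr0 // => j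
  /andP[/eqP->]; rewrite mem_rem_uniq // !inE eqxx.
Qed.

Lemma gwa_grading : is_grading gwa_piece.
Proof.
split; [exact: GP_zero|exact: GP_sub|exact: gwa_span|exact: gwa_free].
Qed.

Definition T : grAlg K :=
  @GrAlg K gwa gwa_in gwa_in_central gwa_piece gwa_grading
    (fun k => GP_base (fg_in R k)) GP_mul.

End GWA.

Arguments T {K} R theta v.

(* Main.v *)
Require Import Defs.
From HB Require Import structures.
From mathcomp Require Import all_boot all_order all_algebra.
From mathcomp Require Import boolp classical_sets reals complex zify.
Import GRing.Theory.

Set Implicit Arguments.
Unset Strict Implicit.
Unset Printing Implicit Defensive.

Local Open Scope ring_scope.

(** Write T(v) for T(R, theta, v), and t+, t- for its two generators.  After
    twisting the R-action on degree i by theta^-i, a graded T(v)-module is a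
    doubly infinite chain of R-modules
      ... <-> M_i <-> M_(i+1) <-> ...
    with R-linear arrows t+ and t- whose composites in both orders are
    multiplication by theta^(i+1)(v).  When v = u w with u and w coprime, the
    link between M_i and M_(i+1) can be cut into two links, one carrying w and
    one carrying u, by inserting a module P_i between them, and this insertion
    is unique: from p in P_i one gets m in M_i and n in M_(i+1), which satisfy
    t- n = u m and t+ m = w n (up to twists), and if a u + b w = 1 then p is
    recovered from (m, n), because (m, n) is the sum of the image of b m and the
    image of a n.  So P_i is the module of all such pairs ([mid]).

    Forgetting the M_i leaves the chain of the P_i, where the link from P_i to
    P_(i+1) passes through M_(i+1) and carries u (of the i-th link) times w (of
    the next one): this is a graded T(theta(w) u)-module ([mid_gr]).  Now u and
    theta(w) are coprime too, so the same insertion applied to the P_i gives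
    back a chain whose terms are the M_(i+1), since these already sit between
    the P_i; a translation of degrees by -1 absorbs the change of index.  Both
    functors are instances of one construction [mid_functor], with different
    twists of the R-action and different translations of the degree, and
    [mid_mid_id] treats both composites at once.  The construction commutes
    with shifts up to rewriting the degrees ([mid_functor_shift]). *)

Lemma additive_at0 (V W : zmodType) (f : V -> W) :
  (forall x y, f (x + y) = f x + f y) -> f 0 = 0.
Proof. by move=> fD; apply: (addIr (f 0)); rewrite -fD !add0r. Qed.

(** * Modules over a generalized Weyl algebra *)

Section Representations.
Context (K : fieldType) (R : fgComAlg K) (theta : algAut R) (v : R).
Local Open Scope quotient_scope.

(** The data from which the universal property of the presentation of T(v)
    produces a module structure on V. *)
Record gwa_rep (V : zmodType) := GwaRep {
  rep_base : R -> V -> V;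
  rep_tp : V -> V;
  rep_tm : V -> V;
  rep_baseDr : forall r x y, rep_base r (x + y) = rep_base r x + rep_base r y;
  rep_tpD : forall x y, rep_tp (x + y) = rep_tp x + rep_tp y;
  rep_tmD : forall x y, rep_tm (x + y) = rep_tm x + rep_tm y;
  rep_baseDl : forall r s x, rep_base (r + s) x = rep_base r x + rep_base s x;
  rep_baseM : forall r s x, rep_base (r * s) x = rep_base r (rep_base s x);
  rep_base1 : forall x, rep_base 1 x = x;
  rep_tpE : forall r x, rep_base r (rep_tp x) = rep_tp (rep_base (theta r) x);
  rep_tmE : forall r x, rep_base (theta r) (rep_tm x) = rep_tm (rep_base r x);
  rep_tmpE : forall x, rep_tm (rep_tp x) = rep_base (theta v) x;
  rep_tpmE : forall x, rep_tp (rep_tm x) = rep_base v x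
}.

Section OneRep.
Context (V : zmodType) (h : gwa_rep V).

Fixpoint rep_term (a : gwa_term R) (x : V) : V :=
  match a with
  | GBase r => rep_base h r x
  | GTp => rep_tp h x
  | GTm => rep_tm h x
  | GAdd a b => rep_term a x + rep_term b x
  | GOpp a => - rep_term a x
  | GMul a b => rep_term a (rep_term b x)
  end.

Lemma rep_base0 x : rep_base h 0 x = 0.
Proof. exact: (additive_at0 (fun r s => rep_baseDl h r s x)). Qed.

Lemma rep_termD a x y : rep_term a (x + y) = rep_term a x + rep_term a y.
Proof.
elim: a x y => [r|||a IHa b IHb|a IHa|a IHa b IHb] x y /=.
- exact: rep_baseDr.
- exact: rep_tpD.
- exact: rep_tmD.
- by rewrite IHa IHb addrACA.
- by rewrite IHa opprD.
- by rewrite IHb IHa.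
Qed.

(** Every generator of the congruence is one of the laws of a representation, or
    follows from additivity of the operators; hence terms act through their
    classes in T(v). *)
Lemma rep_term_eq a b : gwa_eq theta v a b -> rep_term a =1 rep_term b.
Proof.
elim=> {a b} /=.
- by [].
- by move=> a b _ IH x; rewrite IH.
- by move=> a b c _ IH1 _ IH2 x; rewrite IH1.
- by move=> a b c d _ IH1 _ IH2 x; rewrite IH1 IH2.
- by move=> a b _ IH x; rewrite IH.
- by move=> a b c d _ IH1 _ IH2 x; rewrite IH2 IH1.
- by move=> a b c x; rewrite addrA.
- by move=> a b x; rewrite addrC.
- by move=> a x; rewrite rep_base0 add0r.
- by move=> a x; rewrite addNr rep_base0.
- by [].
- by move=> a x; rewrite rep_base1.
- by move=> a x; rewrite rep_base1.
- by [].
- by move=> a b c x; rewrite rep_termD.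
- by move=> r s x; rewrite rep_baseDl.
- by move=> r s x; rewrite rep_baseM.
- by move=> r x; rewrite rep_tpE.
- by move=> r x; rewrite rep_tmE.
- by move=> x; rewrite rep_tmpE.
- by move=> x; rewrite rep_tpmE.
Qed.

Definition rep_scale (a : gwa theta v) (x : V) : V := rep_term (repr a) x.

Lemma rep_scaleE a x : rep_scale (\pi_(gwa theta v) a) x = rep_term a x.
Proof. exact/rep_term_eq/gwa_reprP. Qed.

Lemma rep_scaleA a b x : rep_scale a (rep_scale b x) = rep_scale (a * b) x.
Proof.
elim/quotW: a => a; elim/quotW: b => b.
by rewrite -gwa_piM !rep_scaleE.
Qed.

Lemma rep_scale1 : left_id 1 rep_scale.
Proof.
move=> x; have <- : \pi_(gwa theta v) (GBase 1) = 1 by [].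
by rewrite rep_scaleE /= rep_base1.
Qed.

Lemma rep_scaleDr : right_distributive rep_scale +%R.
Proof. by move=> a x y; apply: rep_termD. Qed.

Lemma rep_scaleDl x : {morph rep_scale^~ x : a b / a + b}.
Proof.
elim/quotW=> a; elim/quotW=> b.
by rewrite -gwa_piD !rep_scaleE.
Qed.

(** An alias of V depending on the representation, so that different
    representations on V can give different module structures. *)
Definition rep_carrier (_ : gwa_rep V) : Type := V.
HB.instance Definition _ := GRing.Zmodule.on (rep_carrier h).
HB.instance Definition _ :=
  GRing.Zmodule_isLmodule.Build (gwa theta v) (rep_carrier h)
    rep_scaleA rep_scale1 rep_scaleDr rep_scaleDl.

Definition rep_lmod : lmodType (gwa theta v) := rep_carrier h.

Lemma rep_lmod_base r (x : rep_lmod) : gwa_base theta v r *: x = rep_base h r x.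
Proof. exact: rep_scaleE. Qed.

Lemma rep_lmod_tp (x : rep_lmod) : gwa_tp theta v *: x = rep_tp h x.
Proof. exact: rep_scaleE. Qed.

Lemma rep_lmod_tm (x : rep_lmod) : gwa_tm theta v *: x = rep_tm h x.
Proof. exact: rep_scaleE. Qed.

End OneRep.

Section Rules.
Context (M : lmodType (gwa theta v)).
Implicit Types (m : M) (r s : R).

Lemma baseZ_scale r s m :
  gwa_base theta v r *: (gwa_base theta v s *: m) =
  gwa_base theta v (r * s) *: m.
Proof. by rewrite scalerA gwa_baseM. Qed.

Lemma baseZ_add r s m :
  gwa_base theta v r *: m + gwa_base theta v s *: m =
  gwa_base theta v (r + s) *: m.
Proof. by rewrite gwa_baseD scalerDl. Qed.

Lemma baseZ_one m : gwa_base theta v 1 *: m = m.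
Proof. exact: scale1r. Qed.

Lemma tpZ_theta r m :
  gwa_tp theta v *: (gwa_base theta v (theta r) *: m) =
  gwa_base theta v r *: (gwa_tp theta v *: m).
Proof. by rewrite !scalerA gwa_tpE. Qed.

Lemma tmZ_base r m :
  gwa_tm theta v *: (gwa_base theta v r *: m) =
  gwa_base theta v (theta r) *: (gwa_tm theta v *: m).
Proof. by rewrite !scalerA gwa_tmE. Qed.

Lemma tmZ_tp m :
  gwa_tm theta v *: (gwa_tp theta v *: m) = gwa_base theta v (theta v) *: m.
Proof. by rewrite scalerA gwa_tmpE. Qed.

Lemma tpZ_tm m :
  gwa_tp theta v *: (gwa_tm theta v *: m) = gwa_base theta v v *: m.
Proof. by rewrite scalerA gwa_tpmE. Qed.

End Rules.

(** The generators of T(v) suffice, because the elements of T(v) on which f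
    commutes with scaling form a subring. *)
Lemma gwa_linear (M N : lmodType (gwa theta v)) (f : M -> N) :
  (forall x y, f (x + y) = f x + f y) ->
  (forall r x, f (gwa_base theta v r *: x) = gwa_base theta v r *: f x) ->
  (forall x, f (gwa_tp theta v *: x) = gwa_tp theta v *: f x) ->
  (forall x, f (gwa_tm theta v *: x) = gwa_tm theta v *: f x) ->
  linear f.
Proof.
move=> fD fb fp fm a x y; rewrite fD; congr (_ + _); move: x {y}.
have f0 := additive_at0 fD.
elim/gwa_ind: a => [r|||a b IHa IHb|a IHa|a b IHa IHb] x //.
- by rewrite !scalerDl fD IHa IHb.
- rewrite !scaleNr; apply: (addIr (f (a *: x))).
  by rewrite -fD !addNr f0 IHa addNr.
- by rewrite -!scalerA IHa IHb.
Qed.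

End Representations.

Local Notation "r ** m" := (gwa_base _ _ r *: m) (at level 40).
Local Notation tp m := (gwa_tp _ _ *: m).
Local Notation tm m := (gwa_tm _ _ *: m).

(** * Inserting a module into each link of a chain *)

Section Mid.
Context (K : fieldType) (R : fgComAlg K) (theta : algAut R).

(** What is needed to pass from T(v)-modules to T(v')-modules by inserting a
    module into each link along v = U W.  The R-action on a pair (m, n) of
    consecutive elements must be twisted by theta between m and n; tau is the
    remaining freedom, the twist on the second entry.  With tau = theta^-1 the
    first entry is not twisted and v' is theta(W) U; with tau = id the second
    entry is not twisted and theta(v') is theta(W) U. *)
Record factor_link (v v' U W : R) (tau : algAut R) : Prop := FactorLink {
  link_comm : forall r, tau (theta r) = theta (tau r);
  link_src : v = U * W;
  link_tgt : theta (tau v') = theta W * U;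
  link_coprime : relatively_prime U W
}.

Lemma theta_inj : injective theta. Proof. exact/bij_inj/aut_bij. Qed.

Section MidModule.
Context (v v' U W : R) (tau : algAut R) (h : factor_link v v' U W tau).
Context (M : lmodType (gwa theta v)).

(** In the untwisted chain, the two conditions are t- n = U m and t+ m = W n. *)
Definition mid_pred : {pred M * M} :=
  fun p => `[< tm p.2 = theta U ** p.1 /\ tp p.1 = W ** p.2 >].

Lemma mid_zmod_closed : zmod_closed mid_pred.
Proof.
split=> [|p q /asboolP[p1 p2] /asboolP[q1 q2]]; apply/asboolP => /=.
  by rewrite !scaler0.
by rewrite !scalerBr p1 p2 q1 q2.
Qed.

HB.instance Definition _ :=
  GRing.isZmodClosed.Build (M * M)%type mid_pred mid_zmod_closed.

Record mid := Mid { mid_val :> M * M; _ : mid_val \in mid_pred }.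

HB.instance Definition _ := [isSub for mid_val].
HB.instance Definition _ := [Choice of mid by <:].
HB.instance Definition _ := [SubChoice_isSubZmodule of mid by <:].

Lemma mid_tm (p : mid) : tm p.2 = theta U ** p.1.
Proof. by case: p => p /= /asboolP[]. Qed.

Lemma mid_tp (p : mid) : tp p.1 = W ** p.2.
Proof. by case: p => p /= /asboolP[]. Qed.

Lemma mid_eq (p q : mid) : p.1 = q.1 -> p.2 = q.2 -> p = q.
Proof.
by case: p q => [[m n] ?] [[m' n'] ?] /= *; apply: val_inj; congr pair.
Qed.

(** Moving U across t+ replaces it with its preimage under theta; this is the
    form in which U occurs in tau(v'). *)
Lemma link_preim : exists2 U0, theta U0 = U & tau v' = W * U0.
Proof.
have [thi _ thK] := aut_bij theta; exists (thi U); first exact: thK.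
by apply: theta_inj; rewrite (link_tgt h) rmorphM /= thK.
Qed.

Lemma mid_lo_subproof m : (theta W ** m, tp m) \in mid_pred.
Proof.
apply/asboolP; split=> /=; last by rewrite tpZ_theta.
rewrite tmZ_tp baseZ_scale; congr (gwa_base _ _ _ *: _).
by rewrite -rmorphM -(link_src h).
Qed.

Lemma mid_hi_subproof n : (tm n, U ** n) \in mid_pred.
Proof.
apply/asboolP; split=> /=; first by rewrite tmZ_base.
rewrite tpZ_tm baseZ_scale; congr (gwa_base _ _ _ *: _).
by rewrite mulrC -(link_src h).
Qed.

(** The arrows from M_i and from M_(i+1) to the module P_i inserted between
    them. *)
Definition mid_lo m : mid := Mid (mid_lo_subproof m).
Definition mid_hi n : mid := Mid (mid_hi_subproof n).

Lemma mid_loD m n : mid_lo (m + n) = mid_lo m + mid_lo n.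
Proof. by apply: mid_eq; rewrite /= scalerDr. Qed.

Lemma mid_hiD m n : mid_hi (m + n) = mid_hi m + mid_hi n.
Proof. by apply: mid_eq; rewrite /= scalerDr. Qed.

(** Coprimality makes the inserted module a direct summand of the pairs: the
    right-hand side is the value at p of an idempotent endomorphism of M x M.
    Through it the homogeneous components of p.1 and p.2 in M give homogeneous
    elements of [mid] with sum p. *)
Lemma mid_span a b (p : mid) : a * U + b * W = 1 ->
  p = mid_lo (theta b ** p.1) + mid_hi (a ** p.2).
Proof.
move=> ab1; apply: mid_eq => /=.
  rewrite tmZ_base mid_tm !baseZ_scale baseZ_add mulrC -!rmorphM -rmorphD.
  by rewrite addrC ab1 rmorph1 baseZ_one.
rewrite tpZ_theta mid_tp !baseZ_scale baseZ_add addrC [U * a]mulrC ab1.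
by rewrite baseZ_one.
Qed.

Lemma mid_base_subproof r (p : mid) :
  (theta (tau r) ** p.1, tau r ** p.2) \in mid_pred.
Proof.
apply/asboolP; split=> /=.
  by rewrite tmZ_base mid_tm !baseZ_scale mulrC.
by rewrite tpZ_theta mid_tp !baseZ_scale mulrC.
Qed.

Definition mid_base r p : mid := Mid (mid_base_subproof r p).

Lemma mid_base_addr r p q : mid_base r (p + q) = mid_base r p + mid_base r q.
Proof. by apply: mid_eq; rewrite /= scalerDr. Qed.

Lemma mid_base_addl r s p : mid_base (r + s) p = mid_base r p + mid_base s p.
Proof. by apply: mid_eq; rewrite /= baseZ_add !rmorphD. Qed.

Lemma mid_base_mul r s p : mid_base (r * s) p = mid_base r (mid_base s p).
Proof. by apply: mid_eq; rewrite /= baseZ_scale !rmorphM. Qed.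

Lemma mid_base_one p : mid_base 1 p = p.
Proof. by apply: mid_eq; rewrite /= !rmorph1 baseZ_one. Qed.

Lemma mid_base_lo r m : mid_base r (mid_lo m) = mid_lo (tau (theta r) ** m).
Proof.
apply: mid_eq; rewrite /= (link_comm h) ?tpZ_theta // !baseZ_scale.
by rewrite mulrC.
Qed.

Lemma mid_base_hi r n : mid_base r (mid_hi n) = mid_hi (tau r ** n).
Proof.
apply: mid_eq; rewrite /= ?tmZ_base // !baseZ_scale.
by rewrite mulrC.
Qed.

Lemma mid_hi_lo (p : mid) : mid_hi (mid_lo p.2).1 = mid_base (theta v') p.
Proof.
apply: mid_eq => /=; last first.
  by rewrite baseZ_scale (link_comm h) (link_tgt h) mulrC.
rewrite tmZ_base mid_tm baseZ_scale (link_comm h) (link_tgt h).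
by rewrite -!rmorphM.
Qed.

Lemma mid_lo_hi (p : mid) : mid_lo (mid_hi p.1).2 = mid_base v' p.
Proof.
have [U0 U0E tauv'] := link_preim; apply: mid_eq => /=.
  by rewrite baseZ_scale (link_tgt h).
by rewrite -U0E tpZ_theta mid_tp baseZ_scale tauv' mulrC.
Qed.

(** The link from P_i to P_(i+1) passes through M_(i+1): upwards through the
    second entry of a pair, downwards through the first. *)
Definition mid_rep : gwa_rep theta v' mid.
Proof.
apply: (@GwaRep _ _ _ _ _ mid_base (fun p : mid => mid_lo p.2)
  (fun p : mid => mid_hi p.1)).
- exact: mid_base_addr.
- by move=> p q; rewrite -mid_loD.
- by move=> p q; rewrite -mid_hiD.
- exact: mid_base_addl.
- exact: mid_base_mul.
- exact: mid_base_one.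
- by move=> r p; apply: mid_base_lo.
- by move=> r p; rewrite mid_base_hi (link_comm h).
- exact: mid_hi_lo.
- exact: mid_lo_hi.
Defined.

Definition mid_lmod : lmodType (gwa theta v') := rep_lmod mid_rep.

Lemma mid_lmod_base r (p : mid_lmod) :
  r ** p = mid_base r p.
Proof. exact: rep_lmod_base. Qed.

Lemma mid_lmod_tp (p : mid_lmod) : tp p = mid_lo (p : mid).2.
Proof. exact: rep_lmod_tp. Qed.

Lemma mid_lmod_tm (p : mid_lmod) : tm p = mid_hi (p : mid).1.
Proof. exact: rep_lmod_tm. Qed.

End MidModule.

(** * The grading and the functor *)

Section Degrees.
Context (v : R) (M : grMod (T R theta v)).
Implicit Types (m : M) (i j : int).

Lemma gm_piece_eq i j m : gm_piece i m -> i = j -> gm_piece j m.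
Proof. by move=> mi <-. Qed.

Lemma gm_piece_base r i m : gm_piece i m -> gm_piece i (r ** m).
Proof.
move=> mi; rewrite -(add0r i); apply: gm_pieceZ => //; exact: GP_base.
Qed.

Lemma gm_piece_tp i m : gm_piece i m -> gm_piece (i + 1) (tp m).
Proof.
move=> mi; rewrite addrC; apply: gm_pieceZ => //; exact: GP_tp.
Qed.

Lemma gm_piece_tm i m : gm_piece i m -> gm_piece (i - 1) (tm m).
Proof.
move=> mi; rewrite addrC; apply: gm_pieceZ => //; exact: GP_tm.
Qed.

End Degrees.

Section MidGraded.
Context (v v' U W : R) (tau : algAut R) (h : factor_link v v' U W tau).
Context (d : int) (M : grMod (T R theta v)).
Let midM := mid_lmod h (gm_mod M).

(** The translation d is 0 for the functor out of T(u w) and -1 for the one in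
    the other direction, where it cancels the index shift of the composites. *)
Definition mid_piece (i : int) : set midM :=
  fun p => gm_piece (i + d) (p : mid U W M).1 /\
           gm_piece (i + d + 1) (p : mid U W M).2.

Lemma mid_piece_lo i (m : M) : gm_piece (i + d) m -> mid_piece i (mid_lo h m).
Proof. by move=> mi; split; [apply: gm_piece_base|apply: gm_piece_tp]. Qed.

Lemma mid_piece_hi i (n : M) :
  gm_piece (i + d + 1) n -> mid_piece i (mid_hi h n).
Proof.
move=> ni; split; last exact: gm_piece_base.
by apply: gm_piece_eq (gm_piece_tm ni) _; rewrite addrK.
Qed.

Lemma mid_grading : is_grading mid_piece.
Proof.
have gM := gm_grading M; split.
- by move=> i; split; apply: grading0.
- by move=> i p q [p1 p2] [q1 q2]; split; apply: gradingB.
- have [a [b ab1]] := link_coprime h.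
  have spanM (f : M -> midM) : (forall x y, f (x + y) = f x + f y) ->
      (forall i x, gm_piece i x -> exists j, mid_piece j (f x)) -> forall x,
      exists2 s : seq midM, (forall y, y \in s -> exists i, mid_piece i y) &
        f x = \sum_(y <- s) y.
    move=> fD fP x; have [s sP ->] := grading_span gM x.
    have f0 := additive_at0 fD.
    exists [seq f y | y <- s]; last by rewrite big_map (big_morph f fD f0).
    by move=> _ /mapP[y /sP[i yi] ->]; apply: fP yi.
  move=> p.
  have [i x xi|s sP sE] :=
    spanM (mid_lo h (M := M)) (mid_loD h (M := M)) _ (theta b ** (p : mid U W M).1).
    by exists (i - d); apply: mid_piece_lo; rewrite subrK.
  have [i x xi|t tP tE] :=
    spanM (mid_hi h (M := M)) (mid_hiD h (M := M)) _ (a ** (p : mid U W M).2).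
    by exists (i - d - 1); apply: mid_piece_hi; apply: gm_piece_eq xi _; lia.
  exists (s ++ t); last first.
    by rewrite big_cat /= -sE -tE; apply: mid_span.
  by move=> y; rewrite mem_cat => /orP[/sP|/tP].
- move=> s f us fP sum0 i i_s; apply: mid_eq.
    apply: (@grading_free _ _ (is_grading_shift d gM) s
      (fun i => (f i : mid U W M).1)) => //.
      by move=> j; case: (fP j).
    have := congr1 (fun p : midM => (p : mid U W M).1) sum0.
    by rewrite (big_morph (fun p : midM => (p : mid U W M).1)
      (id1 := 0) (op1 := +%R)).
  apply: (@grading_free _ _ (is_grading_shift (d + 1) gM) s
    (fun i => (f i : mid U W M).2)) => //.
    by move=> j; rewrite addrA; case: (fP j).
  have := congr1 (fun p : midM => (p : mid U W M).2) sum0.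
  by rewrite (big_morph (fun p : midM => (p : mid U W M).2)
    (id1 := 0) (op1 := +%R)).
Qed.

Lemma mid_pieceZ i j (a : T R theta v') (p : midM) :
  gr_piece i a -> mid_piece j p -> mid_piece (i + j) (a *: p).
Proof.
move=> ai; elim: ai j p => {i a} /= [r|||i|i a b _ IHa _ IHb|i k a b _ IHa _ IHb]
  j p pj.
- rewrite add0r mid_lmod_base; case: pj => p1 p2.
  by split; apply: gm_piece_base.
- rewrite mid_lmod_tp; apply: mid_piece_lo; apply: gm_piece_eq (pj.2) _; lia.
- rewrite mid_lmod_tm; apply: mid_piece_hi; apply: gm_piece_eq (pj.1) _; lia.
- by rewrite scale0r; apply: grading0 mid_grading _.
- by rewrite scalerBl; apply: (gradingB mid_grading); [apply: IHa|apply: IHb].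
- by rewrite -scalerA -addrA; apply: IHa; apply: IHb.
Qed.

Definition mid_gr : grMod (T R theta v') :=
  @GrMod K (T R theta v') midM mid_piece mid_grading mid_pieceZ.

End MidGraded.

Section MidHom.
Context (v v' U W : R) (tau : algAut R) (h : factor_link v v' U W tau).
Context (d : int) (M N : grMod (T R theta v)) (f : grHom M N).

Lemma grHomD x y : f (x + y) = f x + f y.
Proof. by have := gh_linear f 1 x y; rewrite !scale1r. Qed.

Lemma grHomZ a x : f (a *: x) = a *: f x.
Proof.
have := gh_linear f a x 0; rewrite (additive_at0 grHomD).
by rewrite !addr0.
Qed.

Lemma mid_map_subproof (p : mid U W M) : (f p.1, f p.2) \in @mid_pred v U W N.
Proof.
by apply/asboolP; split; rewrite /= -!grHomZ; congr (f _);
  [apply: mid_tm|apply: mid_tp].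
Qed.

Definition mid_map_fun (p : mid_gr h d M) : mid_gr h d N :=
  Mid (mid_map_subproof p).

Definition mid_map : grHom (mid_gr h d M) (mid_gr h d N).
Proof.
exists mid_map_fun.
- apply: gwa_linear => [x y|r x|x|x].
  + by apply: mid_eq; apply: grHomD.
  + by rewrite !mid_lmod_base; apply: mid_eq; apply: grHomZ.
  + by rewrite !mid_lmod_tp; apply: mid_eq; apply: grHomZ.
  + by rewrite !mid_lmod_tm; apply: mid_eq; apply: grHomZ.
- by move=> i p [p1 p2]; split; apply: gh_deg.
Defined.

End MidHom.

Section MidFunctor.
Context (v v' U W : R) (tau : algAut R) (h : factor_link v v' U W tau).
Context (d : int).

Definition mid_functor : grFunctor (T R theta v) (T R theta v').
Proof.
apply: (@GrFunctor K _ _ (mid_gr h d) (mid_map h d)).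
- by move=> M; apply: grHom_ext => p; apply: mid_eq.
- by move=> M N P g f; apply: grHom_ext => p; apply: mid_eq.
Defined.

Lemma mid_functor_klinear : is_klinear mid_functor.
Proof.
move=> M N; split=> [f g|k f]; apply: grHom_ext => p; first exact: mid_eq.
rewrite [RHS](mid_lmod_base (fg_in R k)); apply: mid_eq => /=.
  by rewrite !aut_in.
by rewrite aut_in.
Qed.

Lemma mid_functor_shift (M : grMod (T R theta v)) (n : int) :
  gr_iso (mid_functor (grShift M n)) (grShift (mid_functor M) n).
Proof.
have idl (A : grAlg K) (N : grMod A) : linear (fun x : N => x) by [].
have dnE i : (i + d + n = i + n + d) * (i + d + 1 + n = i + n + d + 1).
  by split; lia.
have to i p : @gm_piece _ _ (mid_functor (grShift M n)) i p ->
              @gm_piece _ _ (grShift (mid_functor M) n) i p.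
  by rewrite /= /mid_piece /= !dnE.
have from i p : @gm_piece _ _ (grShift (mid_functor M) n) i p ->
                @gm_piece _ _ (mid_functor (grShift M n)) i p.
  by rewrite /= /mid_piece /= !dnE.
exists (@GrHom K _ (mid_functor (grShift M n)) (grShift (mid_functor M) n) id
  (idl _ _) to).
exists (@GrHom K _ (grShift (mid_functor M) n) (mid_functor (grShift M n)) id
  (idl _ _) from).
by split; apply: grHom_ext.
Qed.

End MidFunctor.

(** * The two insertions are mutually inverse *)

Section MidMid.
Context (v v' U W U' W' : R) (tau tau' : algAut R).
Context (h : factor_link v v' U W tau) (h' : factor_link v' v U' W' tau').
(* U' and W' are W and U up to the twists: M_(i+1) sits between P_i and        *)
(* P_(i+1) through the link of U followed by that of W.  The condition on      *)
(* tau' makes the two twists cancel.                                           *)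
Hypothesis tauK : forall r, tau (theta (tau' r)) = r.
Hypothesis U'E : tau U' = W.
Hypothesis W'E : theta (tau W') = U.
Hypothesis UW_coprime : relatively_prime U (theta W).
Context (d d' : int) (dE : d + d' = -1).

Section MidMidModule.
Context (M : lmodType (gwa theta v)).
Let midM := mid_lmod h M.
Let midmidM := mid_lmod h' midM.

(** M_(i+1) sits between P_i and P_(i+1), so z in M_(i+1) gives an element of
    each of these, and the pair lies in the module inserted between them. *)
Lemma midmid_subproof (z : M) :
  (mid_hi h z : midM, mid_lo h z : midM) \in @mid_pred v' U' W' midM.
Proof.
apply/asboolP; split; rewrite ?mid_lmod_tm ?mid_lmod_tp mid_lmod_base /=.
  rewrite mid_base_hi -/(mid_hi h _); congr (mid_hi h _).
  by rewrite (link_comm h) U'E.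
rewrite mid_base_lo; congr (mid_lo h _).
by rewrite (link_comm h) W'E.
Qed.

Definition midmid (z : M) : midmidM := Mid (midmid_subproof z).

Lemma midmid_linear : linear midmid.
Proof.
apply: gwa_linear => [x y|r x|x|x].
- by apply: mid_eq; [apply: mid_hiD|apply: mid_loD].
- rewrite mid_lmod_base; apply: mid_eq; rewrite /= mid_lmod_base.
    by rewrite mid_base_hi tauK.
  by rewrite mid_base_lo tauK.
- rewrite mid_lmod_tp; apply: mid_eq; rewrite /= ?mid_lmod_tp //.
  rewrite mid_lmod_base; apply: mid_eq; rewrite /= (link_comm h) W'E.
    rewrite tmZ_tp baseZ_scale; congr (gwa_base _ _ _ *: _).
    by rewrite -rmorphM -(link_src h).
  by [].
- rewrite mid_lmod_tm; apply: mid_eq; rewrite /= ?mid_lmod_tm //.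
  rewrite mid_lmod_base; apply: mid_eq; rewrite /= U'E //.
  rewrite tpZ_tm baseZ_scale; congr (gwa_base _ _ _ *: _).
  by rewrite mulrC -(link_src h).
Qed.

(** For p = midmid z the two entries used here are U z and theta(W) z, and z is
    recovered from them once c U + e theta(W) = 1. *)
Definition midmid_inv c e (p : midmidM) : M :=
  c ** ((p : mid U' W' midM).1 : mid U W M).2 +
  e ** ((p : mid U' W' midM).2 : mid U W M).1.

Lemma midmidK c e z : c * U + e * theta W = 1 -> midmid_inv c e (midmid z) = z.
Proof.
by move=> ce1; rewrite /midmid_inv /= !baseZ_scale baseZ_add ce1 baseZ_one.
Qed.

(** An element p of the twofold insertion has four entries in M, two of degree i
    (named q1.2 and q2.1) and one on each side (q1.1 and q2.2).  The condition
    that p is in the outer insertion, read entrywise, expresses each of them as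
    the entry of midmid z for z = c q1.2 + e q2.1. *)
Lemma midmid_invK c e p :
  c * U + e * theta W = 1 -> midmid (midmid_inv c e p) = p.
Proof.
move=> ce1.
have [thi _ thK] := aut_bij theta.
have := mid_tp p; have := mid_tm p.
rewrite mid_lmod_tm mid_lmod_tp !mid_lmod_base => tmq tpq.
pose q1 : mid U W M := (p : mid U' W' midM).1.
pose q2 : mid U W M := (p : mid U' W' midM).2.
rewrite -/q1 -/q2 in tmq tpq.
set z := midmid_inv c e p.
have zE : z = c ** q1.2 + e ** q2.1 by [].
have := congr1 (fun x : mid U W M => x.1) tmq; rewrite /= => tm1.
have := congr1 (fun x : mid U W M => x.2) tmq; rewrite /= => tm2.
have := congr1 (fun x : mid U W M => x.1) tpq; rewrite /= => tp1.
have := congr1 (fun x : mid U W M => x.2) tpq; rewrite /= => tp2.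
rewrite (link_comm h) U'E in tm1 tm2; rewrite W'E in tp1.
have Uz : U ** z = q1.2.
  rewrite zE scalerDr !baseZ_scale [U * e]mulrC -[(e * U) ** _]baseZ_scale tm2.
  by rewrite baseZ_scale baseZ_add mulrC ce1 baseZ_one.
have Wz : theta W ** z = q2.1.
  rewrite zE scalerDr !baseZ_scale [_ * c]mulrC -[(c * _) ** _]baseZ_scale tp1.
  by rewrite baseZ_scale baseZ_add [theta W * e]mulrC ce1 baseZ_one.
have tmz : tm z = q1.1.
  rewrite zE scalerDr !tmZ_base tm1 mid_tm !baseZ_scale baseZ_add.
  by rewrite -!rmorphM -rmorphD ce1 rmorph1 baseZ_one.
have tpz : tp z = q2.2.
  (* t+ commutes with theta(r) at the cost of replacing it with r, so c and e *)
  (* are written as images under theta.                                       *)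
  rewrite zE scalerDr -[c]thK -[e]thK !tpZ_theta tp2 mid_tp !baseZ_scale.
  rewrite baseZ_add -[RHS]baseZ_one; congr (gwa_base _ _ _ *: _).
  by apply: theta_inj; rewrite rmorphD !rmorphM /= !thK W'E ce1 rmorph1.
by apply: mid_eq; apply: mid_eq.
Qed.

Lemma midmid_inv_linear c e :
  c * U + e * theta W = 1 -> linear (midmid_inv c e).
Proof.
move=> ce1 a x y; apply: (can_inj (fun z => midmidK z ce1)).
have := midmid_linear a (midmid_inv c e x) (midmid_inv c e y).
rewrite (midmid_invK x ce1) (midmid_invK y ce1) => lin.
exact: etrans (midmid_invK _ ce1) (esym lin).
Qed.

End MidMidModule.

Lemma mid_mid_id :
  nat_iso (gf_comp (mid_functor h' d') (mid_functor h d)) (gf_id (T R theta v)).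
Proof.
have [c [e ce1]] := UW_coprime.
have invd (M : grMod (T R theta v)) i p :
    @gm_piece _ _ (mid_gr h' d' (mid_gr h d M)) i p ->
    gm_piece i (@midmid_inv M c e p).
  move=> [[_ p12] [p21 _]]; apply: (gradingD (gm_grading M)).
    by apply: gm_piece_base; apply: gm_piece_eq p12 _; lia.
  by apply: gm_piece_base; apply: gm_piece_eq p21 _; lia.
have midd (M : grMod (T R theta v)) i z : gm_piece i z ->
    @gm_piece _ _ (mid_gr h' d' (mid_gr h d M)) i (@midmid M z).
  move=> zi; split.
    by apply: mid_piece_hi; apply: gm_piece_eq zi _; lia.
  by apply: mid_piece_lo; apply: gm_piece_eq zi _; lia.
exists (fun M => @GrHom _ _ (mid_gr h' d' (mid_gr h d M)) M _
  (@midmid_inv_linear M c e ce1) (@invd M)).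
exists (fun M => @GrHom _ _ M (mid_gr h' d' (mid_gr h d M)) _
  (@midmid_linear M) (@midd M)).
split=> [M|M|M N f]; apply: grHom_ext => x /=.
- exact: midmid_invK.
- exact: midmidK.
- by rewrite /midmid_inv (grHomD f) !(grHomZ f).
Qed.

End MidMid.

End Mid.

(** * The equivalence *)

Section Inverse.
Context (K : fieldType) (R : fgComAlg K).

Definition alg_id : algAut R.
Proof. by exists (GRing.RMorphism.clone _ _ idfun _); [exists id|]. Defined.

Lemma alg_inverse (theta : algAut R) :
  exists2 thi : algAut R, cancel theta thi & cancel thi theta.
Proof.
have [g gK Kg] := aut_bij theta.
have gD : nmod_morphism g.
  by split=> [|x y]; apply: (can_inj gK); rewrite ?rmorph0 ?rmorphD !Kg ?rmorph0.
have gM : monoid_morphism g.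
  by split=> [|x y]; apply: (can_inj gK); rewrite ?rmorph1 ?rmorphM !Kg ?rmorph1.
pose gadd := GRing.isNmodMorphism.Build R R g gD.
pose gmul := GRing.isMonoidMorphism.Build R R g gM.
pose gm : {rmorphism R -> R} := HB.pack g gadd gmul.
have gin k : gm (fg_in R k) = fg_in R k.
  by rewrite -[in LHS](aut_in theta) /= gK.
exists (@AlgAut _ _ gm (Bijective Kg gK) gin); [exact: gK|exact: Kg].
Qed.

End Inverse.

Theorem lemma4p4 (Re : realType) (R : fgComAlg Re[i]) (theta : algAut R)
  (v u w : R) (hv : v = u * w) (huw : relatively_prime u w)
  (hutw : relatively_prime u (theta w)) :
  strongly_graded_Morita_equivalent (T R theta v) (T R theta (theta w * u)).
Proof.
have [thi thiK thK] := alg_inverse theta.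
have sym (x y : R) : relatively_prime x y -> relatively_prime y x.
  by case=> a [b ab1]; exists b, a; rewrite addrC.
have thhuw : relatively_prime (theta w) (theta u).
  case: huw => a [b ab1]; exists (theta b), (theta a).
  by rewrite -!rmorphM -rmorphD addrC ab1 rmorph1.
have hF : factor_link theta v (theta w * u) u w thi.
  by split=> // r; rewrite thiK thK.
have hG : factor_link theta (theta w * u) v (theta w) u (alg_id R).
  by split=> //=; [rewrite hv rmorphM|apply: sym].
(* The functor required goes from T(theta(w) u)-modules to T(v)-modules. *)
exists (mid_functor hG (-1)); split.
- exact: mid_functor_klinear.
- exists (mid_functor hF 0); split.
    by apply: mid_mid_id.
  by apply: mid_mid_id.
- by move=> M; apply: mid_functor_shift.
Qed.
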